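(* Let $n\ge 1$, let $X$ be a smooth vector field on $\mathrm{Sol}_3\times\mathbb{R}^n$ and $(\lambda,\beta_1,\beta_2)\in\mathbb{R}^3$ be such that $(\mathrm{Sol}_3\times\mathbb{R}^n,g,X,\beta_1,\lambda,\beta_2)$ is a Ricci-Yamabe soliton. Then: (i) if $(\beta_1,\beta_2)=(1,0)$, then $(\mathrm{Sol}_3\times\mathbb{R}^n,g,X,\lambda)$ is an expanding Ricci soliton; (ii) if $(\beta_1,\beta_2)=(0,1)$, then $(\mathrm{Sol}_3\times\mathbb{R}^n,g,X,\lambda)$ is a shrinking Yamabe soliton.
   Context: $\mathrm{Sol}_3\times\mathbb{R}^n$ is the Lie group of dimension $3+n$ with global coordinates $(x,y,z,t_1,\dots,t_n)\in\mathbb{R}^{3+n}$, equipped with the left-invariant Riemannian metric $g=e^{2z}dx^2+e^{-2z}dy^2+dz^2+\sum_{k=1}^n dt_k^2$. For a Riemannian manifold $(M,g)$, a smooth vector field $X$ on $M$ and real constants $\beta_1,\lambda,\beta_2$, the sextuple $(M,g,X,\beta_1,\lambda,\beta_2)$ is called a Ricci-Yamabe soliton if $\beta_1\operatorname{Ric}+\frac12\mathcal{L}_Xg=(\lambda+\beta_2\operatorname{Scal})g$ on $M$, where $\operatorname{Ric}$ is the Ricci tensor, $\operatorname{Scal}$ the scalar curvature and $\mathcal{L}_Xg$ the Lie derivative of $g$ along $X$. The quadruple $(M,g,X,\lambda)$ is a Ricci soliton (respectively a Yamabe soliton) when this equation holds with $(\beta_1,\beta_2)=(1,0)$ (respectively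 $(\beta_1,\beta_2)=(0,1)$). Such a soliton is called steady if $\lambda=0$, shrinking if $\lambda>0$, and expanding if $\lambda<0$. Convention: $R(U,V)W=\nabla_U\nabla_VW-\nabla_V\nabla_UW-\nabla_{[U,V]}W$ and $\operatorname{Ric}(U,V)=\sum_j g(R(e_j,U)V,e_j)$ for a local orthonormal frame $(e_j)$ (so round spheres have positive Ricci curvature). *)

(* Defs.v *)
From HB Require Import structures.
From mathcomp Require Import all_boot all_order all_algebra.
From mathcomp Require Import ring lra.
From mathcomp Require Import all_classical all_reals all_analysis.

Set Implicit Arguments.
Unset Strict Implicit.
Unset Printing Implicit Defensive.
Import Order.TTheory GRing.Theory Num.Theory numFieldNormedType.Exports.
Local Open Scope classical_set_scope.
Local Open Scope ring_scope.

(** Riemannian geometry on R^m in one global chart: a point is a row vector of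
    coordinates, a vector field is its row vector of components with respect to
    the coordinate fields. *)

Section Chart.
Context {R : realType} {m : nat}.
Implicit Types (f : 'rV[R]_m -> R) (U V W X : 'rV[R]_m -> 'rV[R]_m).

Definition partial (i : 'I_m) f (p : 'rV[R]_m) : R := 'D_(delta_mx 0 i) f p.

Fixpoint diff_order (k : nat) (A : set 'rV[R]_m) f : Prop :=
  if k is k'.+1 then
    (forall p, A p -> differentiable f p)
    /\ (forall i, diff_order k' A (partial i f))
  else True.

(** [C^oo] on the open set [A]: all iterated partial derivatives exist and are
    differentiable on [A]. *)
Definition smooth_on (A : set 'rV[R]_m) f := forall k, diff_order k A f.

Definition smooth_field_on (A : set 'rV[R]_m) X :=
  forall i, smooth_on A (fun p => X p 0 i).

Definition smooth_field X := smooth_field_on setT X.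

Lemma eq_smooth_on (A : set 'rV[R]_m) h f :
  f =1 h -> smooth_on A h -> smooth_on A f.
Proof. by move=> /funext ->. Qed.

Definition bracket U V (p : 'rV[R]_m) : 'rV[R]_m :=
  'D_(U p) V p - 'D_(V p) U p.

End Chart.

Record riemannian (R : realType) (m : nat) := Riemannian {
  gram :> 'rV[R]_m -> 'M[R]_m;
  gram_smooth : forall i j, smooth_on setT (fun p => gram p i j);
  gram_sym : forall p, (gram p)^T = gram p;
  gram_pos : forall p (v : 'rV[R]_m), v != 0 -> 0 < (v *m gram p *m v^T) 0 0 }.

Section Curvature.
Context {R : realType} {m : nat} (g : riemannian R m).
Implicit Types (U V W X : 'rV[R]_m -> 'rV[R]_m).

Definition inner (p u v : 'rV[R]_m) : R := (u *m g p *m v^T) 0 0.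

(** [christoffel k i j] is the symbol with upper index [k] and lower indices
    [i], [j] of the Levi-Civita connection. *)
Definition christoffel (k i j : 'I_m) (p : 'rV[R]_m) : R :=
  2^-1 * \sum_l invmx (g p) k l *
    (partial i (fun q => g q j l) p + partial j (fun q => g q i l) p
     - partial l (fun q => g q i j) p).

Definition nabla U V (p : 'rV[R]_m) : 'rV[R]_m :=
  'D_(U p) V p + \row_k \sum_i \sum_j christoffel k i j p * U p 0 i * V p 0 j.

Definition riemann U V W (p : 'rV[R]_m) : 'rV[R]_m :=
  nabla U (nabla V W) p - nabla V (nabla U W) p - nabla (bracket U V) W p.

Definition lie_metric X U V (p : 'rV[R]_m) : R :=
  'D_(X p) (fun q => inner q (U q) (V q)) p
  - inner p (bracket X U p) (V p) - inner p (U p) (bracket X V p).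

Definition orthonormal_frame (A : set 'rV[R]_m)
    (e : 'I_m -> 'rV[R]_m -> 'rV[R]_m) :=
  [/\ open A, forall j, smooth_field_on A (e j) &
      forall p, A p -> forall i j, inner p (e i p) (e j p) = (i == j)%:R].

(** Ricci tensor and scalar curvature computed in an orthonormal frame [e];
    the values do not depend on [e]. *)
Definition ricci (e : 'I_m -> 'rV[R]_m -> 'rV[R]_m) U V (p : 'rV[R]_m) : R :=
  \sum_j inner p (riemann (e j) U V p) (e j p).

Definition scal (e : 'I_m -> 'rV[R]_m -> 'rV[R]_m) (p : 'rV[R]_m) : R :=
  \sum_j ricci e (e j) (e j) p.

(** Equality of the two symmetric 2-tensors is tested on all smooth fields, and
    the curvatures are evaluated in any local orthonormal frame. *)
Definition ricci_yamabe_soliton X (b1 lam b2 : R) : Prop :=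
  smooth_field X /\
  forall A e, orthonormal_frame A e ->
  forall U V, smooth_field U -> smooth_field V ->
  forall p, A p ->
    b1 * ricci e U V p + 2^-1 * lie_metric X U V p
    = (lam + b2 * scal e p) * inner p (U p) (V p).

Definition ricci_soliton X (lam : R) := ricci_yamabe_soliton X 1 lam 0.
Definition yamabe_soliton X (lam : R) := ricci_yamabe_soliton X 0 lam 1.

Definition expanding_ricci_soliton X (lam : R) :=
  ricci_soliton X lam /\ lam < 0.
Definition shrinking_yamabe_soliton X (lam : R) :=
  yamabe_soliton X lam /\ 0 < lam.

End Curvature.

Section Sol.
Context {R : realType} {n : nat}.

Definition zidx : 'I_(3 + n) := lshift n (@Ordinal 3 2 isT).

(** Coordinates are ordered as [(x, y, z, t_1, ..., t_n)]. *)
Definition sol_gram (p : 'rV[R]_(3 + n)) : 'M[R]_(3 + n) :=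
  diag_mx (\row_i match val i with
                  | 0%N => expR (2 * p 0 zidx)
                  | 1%N => expR (- 2 * p 0 zidx)
                  | _ => 1
                  end).

Lemma smooth_expz (A : set 'rV[R]_(3 + n)) (c a : R) :
  smooth_on A (fun p => c * expR (a * p 0 zidx)).
Proof.
have dz (p : 'rV[R]_(3 + n)) :
    differentiable (fun q : 'rV[R]_(3 + n) => q 0 zidx) p.
  exact: differentiable_coord.
have daz (p : 'rV[R]_(3 + n)) :
    differentiable (fun q : 'rV[R]_(3 + n) => a * q 0 zidx) p.
  exact: differentiableZ.
have dexp (p : 'rV[R]_(3 + n)) :
    differentiable (fun q : 'rV[R]_(3 + n) => expR (a * q 0 zidx)) p.
  apply: (@differentiable_comp _ _ _ _ (fun q : 'rV[R]_(3 + n) => a * q 0 zidx)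
            expR) => //.
  exact/derivable1_diffP/derivable_expR.
have dall d (p : 'rV[R]_(3 + n)) :
    differentiable (fun q : 'rV[R]_(3 + n) => d * expR (a * q 0 zidx)) p.
  exact: differentiableZ.
move=> k; elim: k c => [//|k IH] c; split=> [p _|i]; first exact: dall.
have -> : partial i (fun p : 'rV[R]_(3 + n) => c * expR (a * p 0 zidx))
    = fun p => (c * a * (zidx == i)%:R) * expR (a * p 0 zidx); last exact: IH.
apply/funext => p; rewrite /partial deriveE; last exact: dall.
rewrite (_ : (fun _ => _) = c *: (expR \o (a *: (fun q : 'rV[R]_(3 + n) => q 0 zidx))));
  last exact/funext.
rewrite diffZ; last exact: dexp.
rewrite diff_comp; [|exact: daz|exact/derivable1_diffP/derivable_expR].
rewrite diffZ; last exact: dz.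
rewrite diff1E; last exact/derivable1_diffP/derivable_expR.
have -> : 'd (fun q : 'rV[R]_(3 + n) => q 0 zidx) p
    = (fun v : 'rV[R]_(3 + n) => v 0 zidx) :> ('rV[R]_(3 + n) -> R).
  have lin : linear (fun v : 'rV[R]_(3 + n) => v 0 zidx : R).
    by move=> b u v; rewrite !mxE.
  pose H := GRing.isLinear.Build _ _ _ _ _ lin.
  pose L : {linear 'rV[R]_(3 + n) -> R} :=
    HB.pack (fun v : 'rV[R]_(3 + n) => v 0 zidx : R) H.
  exact/(@diff_lin _ _ _ L)/coord_continuous.
rewrite /= derive1E derive_val /= !mxE eqxx /=.
by rewrite -[LHS]/(c * ((a * (zidx == i)%:R) * expR (a * p 0 zidx))) !mulrA.
Qed.

Lemma smooth_cst (A : set 'rV[R]_(3 + n)) (c : R) : smooth_on A (cst c).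
Proof.
have := smooth_expz A c 0; congr smooth_on; apply/funext => p.
by rewrite mul0r expR0 mulr1.
Qed.

Fact sol_gram_smooth i j : smooth_on setT (fun p => sol_gram p i j).
Proof.
have [->|ij] := eqVneq i j; last first.
  apply: eq_smooth_on (smooth_cst _ 0).
  by move=> p; rewrite !mxE (negbTE ij) mulr0n.
case: j => -[|[|j]] hj.
- apply: eq_smooth_on (smooth_expz _ 1 2).
  by move=> p; rewrite !mxE eqxx mulr1n mul1r.
- apply: eq_smooth_on (smooth_expz _ 1 (- 2)).
  by move=> p; rewrite !mxE eqxx mulr1n mul1r.
- apply: eq_smooth_on (smooth_cst _ 1).
  by move=> p; rewrite !mxE eqxx mulr1n.
Qed.

Fact sol_gram_sym p : (sol_gram p)^T = sol_gram p.
Proof. exact: tr_diag_mx. Qed.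

Fact sol_gram_pos p (v : 'rV[R]_(3 + n)) :
  v != 0 -> 0 < (v *m sol_gram p *m v^T) 0 0.
Proof.
move=> v0; have [i vi0] : exists i, v 0 i != 0.
  apply/existsP; apply: contraNT v0 => /existsPn v0.
  by apply/eqP/rowP => i; rewrite !mxE; apply/eqP; rewrite -[_ == _]negbK v0.
pose w (j : 'I_(3 + n)) : R := match val j with
  | 0%N => expR (2 * p 0 zidx) | 1%N => expR (- 2 * p 0 zidx) | _ => 1 end.
have w_gt0 j : 0 < w j.
  by rewrite /w; case: (val j) => [|[|?]]; rewrite ?expR_gt0.
have -> : (v *m sol_gram p *m v^T) 0 0 = \sum_j w j * v 0 j ^+ 2.
  rewrite mul_mx_diag mxE; apply: eq_bigr => j _.
  by rewrite !mxE -/(w j) expr2 mulrCA mulrA.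
rewrite (bigD1 i) //=; apply: ltr_pwDl.
  by rewrite mulr_gt0 // exprn_even_gt0.
by apply: sumr_ge0 => j _; rewrite mulr_ge0 ?sqr_ge0 // ltW.
Qed.

Definition sol_metric : riemannian R (3 + n) :=
  Riemannian sol_gram_smooth sol_gram_sym sol_gram_pos.

Definition sol_frame (j : 'I_(3 + n)) (p : 'rV[R]_(3 + n)) : 'rV[R]_(3 + n) :=
  match val j with
  | 0%N => expR (- p 0 zidx)
  | 1%N => expR (p 0 zidx)
  | _ => 1
  end *: delta_mx 0 j.

Lemma sol_frame_orthonormal : orthonormal_frame sol_metric setT sol_frame.
Proof.
split; first exact: openT.
- move=> j i; have [->|ij] := eqVneq i j; last first.
    apply: eq_smooth_on (smooth_cst _ 0).
    by move=> p; rewrite !mxE (negbTE ij) andbF mulr0.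
  case: j => -[|[|j]] hj.
  + apply: eq_smooth_on (smooth_expz _ 1 (- 1)).
    by move=> p; rewrite !mxE !eqxx mulr1 mul1r mulN1r.
  + apply: eq_smooth_on (smooth_expz _ 1 1).
    by move=> p; rewrite !mxE !eqxx mulr1 !mul1r.
  + apply: eq_smooth_on (smooth_cst _ 1).
    by move=> p; rewrite !mxE !eqxx mulr1.
- move=> p _ i j; rewrite /inner mul_mx_diag mxE (bigD1 i) //= big1 ?addr0.
    rewrite !mxE !eqxx /= mulr1 eq_sym.
    have [->|_] := eqVneq; rewrite ?mulr0 ?mulr1 //.
    by case: (val i) => [|[|_]]; rewrite ?mulr1 // -!expRD;
      rewrite (_ : _ + _ = 0) ?expR0 //; ring.
  by move=> k ki; rewrite !mxE (negbTE ki) andbF mulr0 !mul0r.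
Qed.

End Sol.

Arguments sol_metric R n : clear implicits.

(* Main.v *)
Require Import Defs.
From mathcomp Require Import all_boot all_order all_algebra.
From mathcomp Require Import ring lra.
From mathcomp Require Import all_classical all_reals all_analysis.

Set Implicit Arguments.
Unset Strict Implicit.
Unset Printing Implicit Defensive.
Import Order.TTheory GRing.Theory Num.Theory numFieldNormedType.Exports.
Local Open Scope classical_set_scope.
Local Open Scope ring_scope.

(** The sign of [lam] is forced by the three components of the soliton equation
    along the hyperbolic plane (x, z), which determine [lam] as
    [2 * b2 - 2 * b1].

    Write the metric as [\sum_i e^(2 s_i z) dx_i^2] with weights
    [s = (1, -1, 0, ..., 0)], let [S] be the diagonal operator with entries
    [s_i], and let [Z] be the unit vector along z. For the left-invariant fields
    with constant components [u] and [v] in the orthonormal frame, the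
    Levi-Civita connection is the bilinear operation
    [(u, v) |-> <v, Z> S u - <S u, v> Z]. Hence curvature is linear algebra with
    constant coefficients: since [S Z = 0],
    [Ric (u, v) = - tr S <S u, v> - tr (S^2) <u, Z> <v, Z>], which for
    [tr S = 0] and [tr (S^2) = 2] is [- 2 dz^2], with scalar curvature [- 2]
    ([ricci_linv], [scal_sol]).

    Put [L = lam - 2 * b2] and let [a], [f] be the x and z components of [X]
    along a plane (x, z). The zz, xx and xz components of the equation
    ([soliton_frame]) become [f_z = L + 2 * b1], [a_x = L - f] and
    [a_z = - e^(- 2 z) f_x]. The first one says that [f] is affine in z with
    constant slope [c]; then [f_x] does not depend on z and the third equation
    integrates explicitly in z. Comparing with the second one gives [c = 0]
    ([plane_rigidity]), because the exponential is not linear. So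
    [lam = 2 * b2 - 2 * b1], which is [- 2] for Ricci solitons and [2] for
    Yamabe solitons. *)

(** * Derivatives along lines *)

(** Reduces derivatives in direction [v] to derivatives of functions of one
    real variable, and back. *)
Lemma is_derive_line (R : realType) (V W : normedModType R) (f : V -> W)
    (a v : V) (t : R) (d : W) :
  is_derive t (1 : R) (fun s : R => f (a + s *: v)) d <->
  is_derive (a + t *: v) v f d.
Proof.
have quot : (fun h : R => h^-1 *: (((fun s : R => f (a + s *: v)) \o shift t)
        (h *: (1 : R)) - f (a + t *: v)))
    = (fun h : R => h^-1 *: ((f \o shift (a + t *: v)) (h *: v)
        - f (a + t *: v))).
  by apply/funext => h /=; rewrite [_ *: 1]mulr1 scalerDl addrCA.
have dq : derivable (fun s : R => f (a + s *: v)) t (1 : R)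
    = derivable f (a + t *: v) v by rewrite /derivable quot.
have eq : 'D_(1 : R) (fun s : R => f (a + s *: v)) t = 'D_v f (a + t *: v).
  by rewrite /derive quot.
by split=> -[df <-]; split; rewrite ?eq// -?dq// dq.
Qed.

(** * Rigidity of the soliton system in a plane *)

Section Plane.
Context {R : realType}.
Implicit Types a f fx : R -> R -> R.

(** Integrating along z from z = 0 instead of comparing mixed partial
    derivatives requires no second derivative of [a]. *)
Lemma plane_rigidity a f fx (L c : R) :
  (forall x z, is_derive z (1 : R) (f x) c) ->
  (forall x z, is_derive x (1 : R) (f^~ z) (fx x z)) ->
  (forall x z, is_derive x (1 : R) (a^~ z) (L - f x z)) ->
  (forall x z, is_derive z (1 : R) (a x) (- expR (- 2 * z) * fx x z)) ->
  c = 0.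
Proof.
move=> fz dfx ax az.
have fE x z : f x z = f x 0 + c * z.
  have : f x z - c * z = f x 0 - c * 0.
    apply: (is_derive_0_is_cst (f := fun t => f x t - c * t)) => t.
    have := fz x t => ?.
    by apply: is_derive_eq; rewrite scaler1 subrr.
  by move/eqP; rewrite mulr0 subr0 subr_eq => /eqP.
have fxE x z : fx x z = fx x 0.
  have /@derive_val <- := dfx x z; have := dfx x 0 => ?.
  rewrite (_ : f^~ z = fun t => f t 0 + c * z); last exact/funext.
  by rewrite derive_val addr0.
have aE x z : a x z = a x 0 + fx x 0 * ((expR (- 2 * z) - 1) / 2).
  have : a x z - (fx x 0 / 2) * expR (- 2 * z)
       = a x 0 - (fx x 0 / 2) * expR (- 2 * 0).
    apply: (is_derive_0_is_cst
      (f := fun t => a x t - (fx x 0 / 2) * expR (- 2 * t))) => t.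
    have := az x t => ?.
    have ? : is_derive t (1 : R) (expR \o ( *%R (- 2))) (expR (- 2 * t) * (- 2)).
      by apply: is_derive1_comp; apply: is_derive_eq; rewrite [_ *: 1]mulr1.
    apply: is_derive_eq; rewrite fxE /GRing.scale /=; by field.
  rewrite mulr0 expR0; lra.
pose k z : R := (expR (- 2 * z) - 1) / 2.
(* The differences [a x z - a x 0] for [z = 1] and [z = - 1] are multiples of
   the same function of x, with factors [k 1] and [k (- 1)]; their x-derivatives
   are [- c] and [c]. *)
have lin : k (- 1) * (- (c * 1)) = k 1 * (- (c * - 1)).
  have D z : is_derive 0 (1 : R) (fun x => a x z - a x 0) (- (c * z)).
    have := ax 0 z => ?; have := ax 0 0 => ?.
    by apply: is_derive_eq; rewrite (fE 0 z); lra.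
  have E : k (- 1) *: (fun x => a x 1 - a x 0)
      = k 1 *: (fun x => a x (- 1) - a x 0).
    apply/funext => x.
    rewrite -[LHS]/(k (- 1) * (a x 1 - a x 0)).
    rewrite -[RHS]/(k 1 * (a x (- 1) - a x 0)).
    rewrite (aE x 1) (aE x (- 1)) -/(k 1) -/(k (- 1)); ring.
  have DZ y z : 'D_(1 : R) (k y *: (fun x => a x z - a x 0)) 0
      = k y * (- (c * z)).
    by have := D z => ?; rewrite derive_val.
  by rewrite -!DZ E.
have k_gt0 : 0 < k 1 + k (- 1).
  have -> : k 1 + k (- 1) = (expR 1 - expR (- 1)) ^+ 2 / 2.
    have e1 : expR (- 2 * 1) = expR (- 1) * expR (- 1) :> R.
      by rewrite -expRD; congr expR; lra.
    have e2 : expR (- 2 * - 1) = expR 1 * expR 1 :> R.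
      by rewrite -expRD; congr expR; lra.
    have e3 : expR 1 * expR (- 1) = 1 :> R by rewrite -expRD subrr expR0.
    rewrite /k e1 e2; lra.
  by rewrite divr_gt0// exprn_even_gt0//= subr_eq0 gt_eqF// ltr_expR; lra.
have : c * (k 1 + k (- 1)) = 0 by lra.
by move/eqP; rewrite mulf_eq0 (gt_eqF k_gt0) orbF => /eqP.
Qed.

End Plane.

(** * The metric in the left-invariant frame *)

Lemma sum_delta (R : pzSemiRingType) (I : finType) (k : I) (F : I -> R) :
  \sum_j (j == k)%:R * F j = F k.
Proof.
rewrite (bigD1 k) //= eqxx mul1r big1 ?addr0 // => j jk.
by rewrite (negbTE jk) mul0r.
Qed.

Section SolGeometry.
Context {R : realType} {n : nat}.
Local Notation m := (3 + n)%N.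
Local Notation z := (@zidx n).
Local Notation vec := ('I_m -> R).
Local Notation vfield := ('rV[R]_m -> 'rV[R]_m).
Implicit Types (a b c : vec) (p v : 'rV[R]_m) (i j k : 'I_m).

(** Half the logarithmic z-derivatives of the diagonal coefficients of the
    metric: with them x, y, z and the t_k are treated by the same formulas. *)
Definition weight i : R :=
  match val i with 0%N => 1 | 1%N => - 1 | _ => 0 end.

Lemma weight_z : weight z = 0. Proof. by []. Qed.

Lemma sum_weight : \sum_i weight i = 0.
Proof.
rewrite big_split_ord /= !big_ord_recl big_ord0 big1 => [|i _];
  rewrite /weight //=.
by rewrite !addr0 subrr.
Qed.

Lemma sum_weight2 : \sum_i weight i ^+ 2 = 2.
Proof.
rewrite big_split_ord /= !big_ord_recl big_ord0 big1 => [|i _];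
  rewrite /weight /= ?expr0n //.
by rewrite sqrrN expr1n !addr0.
Qed.

(** The left-invariant field whose components in [sol_frame] are [a]. *)
Definition linv a : vfield := fun p => \row_k (a k * expR (- weight k * p 0 z)).

Definition basis j : vec := fun k => (k == j)%:R.

Lemma sol_gramE p i j :
  sol_gram p i j = (i == j)%:R * expR (2 * weight i * p 0 z).
Proof.
rewrite !mxE; have [->|] := eqVneq i j; last by rewrite mulr0n mul0r.
rewrite mulr1n mul1r /weight.
by case: (val j) => [|[|?]]; rewrite ?mulr1 ?mulrN1 ?mulr0 ?mul0r ?expR0.
Qed.

Lemma sol_frameE j : sol_frame j = linv (basis j).
Proof.
apply/funext => p; apply/rowP => k; rewrite !mxE /basis /=.
have [->|_] := eqVneq k j; last by rewrite mulr0 mul0r.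
rewrite mulr1 mul1r /weight /=.
by case: (nat_of_ord j) => [|[|?]];
  rewrite ?mulN1r ?opprK ?oppr0 ?mul0r ?mul1r ?expR0.
Qed.

Lemma sol_frame_smooth j : smooth_field (@sol_frame R n j).
Proof. by have [_ + _] := @sol_frame_orthonormal R n; exact. Qed.

Lemma invmx_sol_gram p i j :
  invmx (sol_gram p) i j = (i == j)%:R * expR (- (2 * weight i * p 0 z)).
Proof.
pose B : 'M[R]_m :=
  \matrix_(i, j) ((i == j)%:R * expR (- (2 * weight i * p 0 z))).
have AB : sol_gram p *m B = 1%:M.
  apply/matrixP => i' j'; rewrite !mxE (bigD1 i') //= big1 ?addr0.
    rewrite sol_gramE mxE eqxx mul1r mulrCA -expRD subrr expR0 mulr1.
    by case: eqP.
  by move=> k ki; rewrite sol_gramE eq_sym (negbTE ki) !mul0r.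
have [U _] := mulmx1_unit AB.
have -> : invmx (sol_gram p) = B.
  by rewrite -[RHS]mul1mx -(mulVmx U) -mulmxA AB mulmx1.
by rewrite mxE.
Qed.

Lemma is_derive_expz (c w : R) p v :
  is_derive p v (fun q : 'rV[R]_m => c * expR (w * q 0 z))
    (c * (w * v 0 z) * expR (w * p 0 z)).
Proof.
rewrite -[p in is_derive p](addr0 p) -[X in p + X](scale0r v).
apply/is_derive_line => /=.
pose u : R -> R := fun s => w * p 0 z + (w * v 0 z) * s.
have -> : (fun s : R => c * expR (w * (p + s *: v) 0 z)) = c *: (expR \o u).
  apply/funext => s; rewrite -[RHS]/(c * expR _) !mxE; congr (c * expR _).
  rewrite /u; ring.
have du : is_derive (0 : R) 1 u (w * v 0 z).
  by rewrite /u; apply: is_derive_eq; rewrite add0r [_ *: 1]mulr1 ?mul1r.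
have deu := @is_derive1_comp R expR u 0 _ _ (is_derive_expR (u 0)) du.
have -> : c * (w * v 0 z) * expR (w * p 0 z) = c *: (expR (u 0) * (w * v 0 z)).
  rewrite /u mulr0 addr0 -[RHS]/(c * _); ring.
exact: is_deriveZ.
Qed.

Lemma derivable_linv a p v : derivable (linv a) p v.
Proof.
apply/derivable_mxP => i j.
rewrite (_ : (fun q => _) = fun q : 'rV[R]_m => a j * expR (- weight j * q 0 z)).
  by have [] := is_derive_expz (a j) (- weight j) p v.
by apply/funext => q; rewrite mxE.
Qed.

Lemma derive_linv a p v k :
  ('D_v (linv a) p) 0 k
  = - (v 0 z * weight k * a k) * expR (- weight k * p 0 z).
Proof.
rewrite derive_mx; last exact: derivable_linv.
rewrite mxE.
have -> : (fun q => linv a q 0 k) = (fun q => a k * expR (- weight k * q 0 z)).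
  by apply/funext => q; rewrite mxE.
have -> := @derive_val _ _ _ _ _ _ _ (is_derive_expz (a k) (- weight k) p v).
ring.
Qed.

(** * The Levi-Civita connection *)

Lemma partial_gram k i j p :
  partial k (fun q => sol_metric R n q i j) p
  = (i == j)%:R * (k == z)%:R * (2 * weight i) * expR (2 * weight i * p 0 z).
Proof.
rewrite /partial.
have -> : (fun q => sol_metric R n q i j)
    = (fun q => (i == j)%:R * expR ((2 * weight i) * q 0 z)).
  by apply/funext => q; rewrite -sol_gramE.
have -> := @derive_val _ _ _ _ _ _ _
  (is_derive_expz (i == j)%:R (2 * weight i) p (delta_mx 0 k)).
rewrite mxE eqxx (eq_sym z) /=; ring.
Qed.

(** In the first term the exponentials of the metric and of its inverse cancel;
    in the second one the inverse contributes [1] because [weight z = 0]. *)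
Lemma christoffelE k i j p :
  christoffel (sol_metric R n) k i j p
  = weight k * ((i == z)%:R * (j == k)%:R + (j == z)%:R * (i == k)%:R)
    - (k == z)%:R * (i == j)%:R * weight i * expR (2 * weight i * p 0 z).
Proof.
rewrite /christoffel.
under eq_bigr => l _ do
  rewrite invmx_sol_gram !partial_gram (eq_sym k l) -(mulrA (l == k)%:R).
rewrite sum_delta.
have [->|kz] := eqVneq k z.
  have wz l r : (l == z)%:R * r * (2 * weight l) = 0.
    by have [->|_] := eqVneq l z; rewrite ?weight_z ?mul0r ?mulr0.
  rewrite !wz weight_z mulr0 !mul0r oppr0 expR0.
  by field.
have E : expR (- (2 * weight k * p 0 z)) * expR (2 * weight k * p 0 z) = 1.
  by rewrite -expRD addNr expR0.
rewrite mulr0 !mul0r !subr0.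
have -> : (j == k)%:R * (i == z)%:R * (2 * weight j)
    * expR (2 * weight j * p 0 z)
   = (j == k)%:R * (i == z)%:R * (2 * weight k) * expR (2 * weight k * p 0 z).
  by have [->//|_] := eqVneq j k; rewrite !mul0r.
have -> : (i == k)%:R * (j == z)%:R * (2 * weight i)
    * expR (2 * weight i * p 0 z)
   = (i == k)%:R * (j == z)%:R * (2 * weight k) * expR (2 * weight k * p 0 z).
  by have [->//|_] := eqVneq i k; rewrite !mul0r.
rewrite -[RHS]mul1r -[X in _ = X * _]E; by field.
Qed.

Definition dot a b : R := \sum_i a i * b i.

(** The covariant derivative on left-invariant fields,
    [<b, Z> S a - <S a, b> Z] for [S] the diagonal operator of the weights and
    [Z] the unit vector along z. *)
Definition conn a b : vec := fun k =>
  weight k * a k * b z - (k == z)%:R * dot (weight \* a) b.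

Lemma innerE p (u v : 'rV[R]_m) :
  inner (sol_metric R n) p u v
  = \sum_i expR (2 * weight i * p 0 z) * u 0 i * v 0 i.
Proof.
rewrite /inner mxE; apply: eq_bigr => i _.
rewrite mxE (eq_bigr (fun k =>
  (k == i)%:R * (u 0 i * expR (2 * weight i * p 0 z)))).
  by rewrite sum_delta !mxE; ring.
move=> k _; rewrite sol_gramE.
have [->|_] := eqVneq k i; last by rewrite !mul0r mulr0.
by ring.
Qed.

Lemma inner_linv a b p :
  inner (sol_metric R n) p (linv a p) (linv b p) = dot a b.
Proof.
rewrite innerE; apply: eq_bigr => i _; rewrite !mxE.
transitivity (a i * b i * (expR (- weight i * p 0 z)
   * expR (- weight i * p 0 z) * expR (2 * weight i * p 0 z))); first by ring.
by rewrite -!expRD [X in expR X](_ : _ = 0) ?expR0 ?mulr1//; ring.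
Qed.

Lemma sum_christoffel k p (u v : vec) :
  \sum_i \sum_j christoffel (sol_metric R n) k i j p * u i * v j
  = weight k * (u z * v k + u k * v z)
    - (k == z)%:R * \sum_i expR (2 * weight i * p 0 z) * (weight i * u i) * v i.
Proof.
transitivity (\sum_i ((i == z)%:R * (weight k * u i * v k)
    + (i == k)%:R * (weight k * u i * v z)
    - (k == z)%:R * (expR (2 * weight i * p 0 z) * (weight i * u i) * v i))).
  apply: eq_bigr => i _.
  transitivity (\sum_j ((j == k)%:R * ((i == z)%:R * (weight k * u i * v j))
      + (j == z)%:R * ((i == k)%:R * (weight k * u i * v j))
      + (j == i)%:R * - ((k == z)%:R
          * (expR (2 * weight i * p 0 z) * (weight i * u i) * v j)))).
    by apply: eq_bigr => j _; rewrite christoffelE (eq_sym i j); ring.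
  by rewrite !big_split /= !sum_delta.
rewrite sumrB big_split /= !sum_delta mulr_sumr; ring.
Qed.

(** The derivative of the components of [linv b] contributes
    [- weight k * a z * b k], which cancels one half of the symmetric
    Christoffel term and leaves [weight k * a k * b z]. *)
Lemma nabla_linv a b :
  nabla (sol_metric R n) (linv a) (linv b) = linv (conn a b).
Proof.
apply/funext => p; apply/rowP => k.
rewrite /nabla mxE [X in _ + X]mxE derive_linv.
rewrite (sum_christoffel k p (linv a p 0) (linv b p 0)).
have -> : \sum_i expR (2 * weight i * p 0 z) * (weight i * linv a p 0 i)
      * linv b p 0 i
   = dot (weight \* a) b.
  rewrite -(inner_linv _ _ p) innerE; apply: eq_bigr => i _.
  by rewrite !mxE /= !mulrA.
rewrite !mxE weight_z oppr0 mul0r expR0 /conn.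
have [->|_] := eqVneq k z; rewrite ?mulr1n ?mulr0n; last by ring.
by rewrite weight_z oppr0 !mul0r expR0; ring.
Qed.

Lemma linvB a b p : linv a p - linv b p = linv (a \- b) p.
Proof. by apply/rowP => k; rewrite !mxE /=; ring. Qed.

Lemma bracket_linv a b :
  bracket (linv a) (linv b) = linv (conn a b \- conn b a).
Proof.
apply/funext => p; apply/rowP => k.
rewrite /bracket mxE [X in _ + X]mxE !derive_linv !mxE.
rewrite weight_z oppr0 mul0r expR0 /= /conn.
have -> : dot (weight \* a) b = dot (weight \* b) a.
  by apply: eq_bigr => i _ /=; ring.
ring.
Qed.

(** * Curvature *)

Definition curv a b c : vec :=
  conn a (conn b c) \- conn b (conn a c) \- conn (conn a b \- conn b a) c.

Lemma riemann_linv a b c p :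
  riemann (sol_metric R n) (linv a) (linv b) (linv c) p = linv (curv a b c) p.
Proof. by rewrite /riemann !nabla_linv bracket_linv nabla_linv !linvB. Qed.

Lemma dot_basisr a j : dot a (basis j) = a j.
Proof.
by rewrite /dot -(sum_delta j a); apply: eq_bigr => i _; rewrite mulrC.
Qed.

Lemma conn_basisl b j k :
  conn (basis j) b k = weight j * ((k == j)%:R * b z - (k == z)%:R * b j).
Proof.
rewrite /conn (_ : dot _ _ = weight j * b j); last first.
  rewrite -(sum_delta j (fun i => weight i * b i)).
  by apply: eq_bigr => i _; rewrite /basis /=; ring.
by rewrite /basis; have [->|_] := eqVneq k j; rewrite ?mulr1n ?mulr0n; ring.
Qed.

Lemma conn_basisr b j k :
  conn b (basis j) k
  = (j == z)%:R * (weight k * b k) - (k == z)%:R * (weight j * b j).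
Proof. by rewrite /conn dot_basisr /= /basis (eq_sym z j); ring. Qed.

(** The contribution of the frame vector [j] to the Ricci form, arranged so that
    summing over [j] yields traces of [S] and [S^2]: the first and the last term
    then cancel. *)
Lemma curv_basis b c j :
  dot (curv (basis j) b c) (basis j)
  = weight j ^+ 2 * (b j * c j) - weight j * dot (weight \* b) c
    - weight j ^+ 2 * (b z * c z)
    - (j == z)%:R * dot (weight \* (weight \* b)) c.
Proof.
rewrite dot_basisr /curv /= conn_basisl eqxx mul1r.
have conn_z u (v : vec) : conn u v z = - dot (weight \* u) v.
  by rewrite /conn weight_z eqxx mulr1n; ring.
have connzl u : conn (basis z) u = fun=> 0.
  by apply/funext => k; rewrite conn_basisl weight_z mul0r.
have dot0 u : dot u (fun=> 0) = 0 by apply: big1 => i _; rewrite mulr0.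
have conn_j u (v : vec) : conn u v j
    = weight j * u j * v z - (j == z)%:R * dot (weight \* u) v by [].
rewrite (conn_j b (conn _ _)) (conn_j (_ \- _)) /=.
rewrite !conn_basisl conn_basisr conn_z !eqxx !mulr1n.
have [->|_] := eqVneq j z.
  rewrite connzl dot0 weight_z mulr1n.
  have -> : dot (weight \* (conn (basis z) b \- conn b (basis z))) c
      = - dot (weight \* (weight \* b)) c.
    rewrite /dot -sumrN; apply: eq_bigr => i _ /=.
    by rewrite conn_basisr connzl eqxx weight_z mulr1n; ring.
  ring.
rewrite !mulr0n; ring.
Qed.

Lemma ricci_linv b c p :
  ricci (sol_metric R n) (@sol_frame R n) (linv b) (linv c) p
  = - 2 * (b z * c z).
Proof.
rewrite /ricci (eq_bigr (fun j => dot (curv (basis j) b c) (basis j))); last first.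
  by move=> j _; rewrite sol_frameE riemann_linv inner_linv.
rewrite (eq_bigr _ (fun j _ => curv_basis b c j)) !sumrB.
rewrite (sum_delta z (fun=> dot (weight \* (weight \* b)) c)).
rewrite -!mulr_suml sum_weight sum_weight2.
rewrite (_ : \sum_i _ = dot (weight \* (weight \* b)) c); first by ring.
by apply: eq_bigr => i _ /=; ring.
Qed.

Lemma scal_sol p : scal (sol_metric R n) (@sol_frame R n) p = - 2.
Proof.
rewrite /scal (eq_bigr (fun j => (j == z)%:R * (- 2))).
  by rewrite (sum_delta z (fun=> - 2)).
move=> j _; rewrite !sol_frameE ricci_linv /basis eq_sym.
by case: (j == z); rewrite ?mulr0 ?mul0r ?mulr1 ?mul1r.
Qed.

(** * The soliton equation in the frame *)

(** The frame is orthonormal, so only the brackets of [X] with the frame fields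
    contribute. *)
Lemma lie_metric_frame (X : vfield) i j p :
  smooth_field X ->
  lie_metric (sol_metric R n) X (sol_frame i) (sol_frame j) p
  = (i == j)%:R * (2 * weight i * X p 0 z)
    + expR ((weight j - weight i) * p 0 z) * partial i (fun q => X q 0 j) p
    + expR ((weight i - weight j) * p 0 z) * partial j (fun q => X q 0 i) p.
Proof.
move=> smX.
have dX k : differentiable (fun q => X q 0 k) p.
  by have [+ _] := smX k 1%N; exact.
have brE (i' j' : 'I_m) : bracket X (linv (basis i')) p 0 j'
    = - expR (- weight i' * p 0 z) *
      ((i' == j')%:R * weight i' * X p 0 z + partial i' (fun q => X q 0 j') p).
  rewrite /bracket mxE [X in _ + X]mxE derive_linv derive_mx; last first.
    by apply/derivable_mxP => k l; rewrite ord1; exact: diff_derivable.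
  rewrite mxE /partial.
  have -> : linv (basis i') p = expR (- weight i' * p 0 z) *: delta_mx 0 i'.
    apply/rowP => k; rewrite !mxE eqxx /= /basis.
    by have [->|] := eqVneq k i'; rewrite ?mul0r ?mulr0 ?mulr1 ?mul1r.
  have -> : 'D_(expR (- weight i' * p 0 z) *: delta_mx 0 i')
        (fun q => X q 0 j') p
      = expR (- weight i' * p 0 z) * 'D_(delta_mx 0 i') (fun q => X q 0 j') p.
    by rewrite !deriveE // linearZ.
  rewrite /basis (eq_sym j' i').
  by have [->|_] := eqVneq i' j'; rewrite ?mulr1n ?mulr0n; ring.
have innerl u k : inner (sol_metric R n) p u (linv (basis k) p)
    = expR (weight k * p 0 z) * u 0 k.
  rewrite innerE -(sum_delta k (fun l => expR (weight l * p 0 z) * u 0 l)).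
  apply: eq_bigr => l _; rewrite mxE /basis.
  rewrite (_ : 2 * weight l * p 0 z = weight l * p 0 z + weight l * p 0 z);
    last by ring.
  rewrite expRD mulNr expRN; field.
  by rewrite gt_eqF // expR_gt0.
have innerC u v : inner (sol_metric R n) p u v = inner (sol_metric R n) p v u.
  by rewrite !innerE; apply: eq_bigr => l _; ring.
rewrite !sol_frameE /lie_metric.
rewrite (_ : (fun q => inner _ _ _ _) = cst (dot (basis i) (basis j))); last first.
  by apply/funext => q; exact: inner_linv.
rewrite derive_cst [X in _ - X = _]innerC.
have := brE i j; have := brE j i.
(* Pairing with a frame vector reads off a single entry of each bracket. *)
move: (bracket X (linv (basis i)) p) (bracket X (linv (basis j)) p) => u v uE vE.
rewrite innerl innerl uE vE.
rewrite !mulrBl !expRD !mulNr (eq_sym j i) !expRN.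
have [->|_] := eqVneq i j; rewrite ?mulr1n ?mulr0n; field;
  by rewrite ?gt_eqF ?expR_gt0.
Qed.

Lemma soliton_frame (X : vfield) (b1 lam b2 : R) i j p :
  ricci_yamabe_soliton (sol_metric R n) X b1 lam b2 ->
  (i == j)%:R * (weight i * X p 0 z)
    + 2^-1 *
      (expR ((weight j - weight i) * p 0 z) * partial i (fun q => X q 0 j) p
       + expR ((weight i - weight j) * p 0 z) * partial j (fun q => X q 0 i) p)
  = (lam - 2 * b2) * (i == j)%:R + 2 * b1 * ((i == z)%:R * (j == z)%:R).
Proof.
move=> [smX sol].
have := sol setT _ (@sol_frame_orthonormal R n) _ _
  (sol_frame_smooth i) (sol_frame_smooth j) p I.
rewrite scal_sol lie_metric_frame //.
have [_ _ orth] := @sol_frame_orthonormal R n.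
rewrite (orth p I) !sol_frameE ricci_linv /basis !(eq_sym z) => H.
lra.
Qed.

(** The equations of [plane_rigidity] hold along the coordinate plane (x, z)
    through the origin. *)
Lemma soliton_constants (X : vfield) (b1 lam b2 : R) :
  ricci_yamabe_soliton (sol_metric R n) X b1 lam b2 -> lam = 2 * b2 - 2 * b1.
Proof.
move=> sol; have [smX _] := sol.
have dX k p : differentiable (fun q => X q 0 k) p.
  by have [+ _] := smX k 1%N; exact.
have E i j p := soliton_frame i j p sol.
pose x : 'I_m := lshift n (@Ordinal 3 0 isT).
have xz : (x == z) = false by [].
have wx : weight x = 1 by [].
pose P (s t : R) : 'rV[R]_m := s *: delta_mx 0 x + t *: delta_mx 0 z.
have Pz s t : P s t 0 z = t.
  by rewrite !mxE !eqxx (eq_sym z) xz /= mulr0 mulr1 add0r.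
have dPz s t k : is_derive t (1 : R) (fun t => X (P s t) 0 k)
    (partial z (fun q => X q 0 k) (P s t)).
  apply/(@is_derive_line _ _ _ (fun q => X q 0 k)).
  by split=> //; exact: diff_derivable.
have dPx s t k : is_derive s (1 : R) (fun s => X (P s t) 0 k)
    (partial x (fun q => X q 0 k) (P s t)).
  rewrite /P addrC; under eq_fun do rewrite addrC.
  apply/(@is_derive_line _ _ _ (fun q => X q 0 k)).
  by split=> //; exact: diff_derivable.
suff : lam - 2 * b2 + 2 * b1 = 0 by lra.
pose a s t := X (P s t) 0 x.
pose f s t := X (P s t) 0 z.
pose fx s t := partial x (fun q => X q 0 z) (P s t).
have fz s t : is_derive t (1 : R) (f s) (lam - 2 * b2 + 2 * b1).
  suff -> : lam - 2 * b2 + 2 * b1 = partial z (fun q => X q 0 z) (P s t).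
    exact: dPz.
  have := E z z (P s t); rewrite eqxx mulr1n weight_z subrr !mul0r expR0; lra.
have ax s t : is_derive s (1 : R) (a^~ t) (lam - 2 * b2 - f s t).
  suff -> : lam - 2 * b2 - f s t = partial x (fun q => X q 0 x) (P s t).
    exact: dPx.
  have := E x x (P s t).
  rewrite eqxx xz mulr1n mulr0n wx subrr !mul0r expR0 -/(f s t); lra.
have az s t : is_derive t (1 : R) (a s) (- expR (- 2 * t) * fx s t).
  suff -> : - expR (- 2 * t) * fx s t = partial z (fun q => X q 0 x) (P s t).
    exact: dPz.
  have := E x z (P s t).
  rewrite xz mulr0n wx weight_z Pz sub0r subr0 !mul1r mulN1r -/(fx s t).
  have -> : expR (- 2 * t) = expR (- t) * expR (- t).
    by rewrite -expRD; congr expR; ring.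
  have : expR t * expR (- t) = 1 by rewrite -expRD subrr expR0.
  move: (expR t) (expR (- t)) (fx s t) (partial _ _ _) => u w d1 d2 uw H.
  (* [u * w = 1], so multiplying the xz equation by [w] isolates [d2]. *)
  have : w * (w * d1 + u * d2) = 0.
    by rewrite (_ : w * d1 + u * d2 = 0) ?mulr0//; lra.
  rewrite mulrDr (mulrA w u) (mulrC w u) uw; lra.
exact: (plane_rigidity fz (fun s t => dPx s t z) ax az).
Qed.

End SolGeometry.

Theorem corollary3p2 (R : realType) (n : nat) (n_ge1 : (1 <= n)%N)
    (X : 'rV[R]_(3 + n) -> 'rV[R]_(3 + n)) (X_smooth : smooth_field X)
    (lam b1 b2 : R)
    (X_soliton : ricci_yamabe_soliton (sol_metric R n) X b1 lam b2) :
  ((b1, b2) = (1, 0) -> expanding_ricci_soliton (sol_metric R n) X lam) /\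
  ((b1, b2) = (0, 1) -> shrinking_yamabe_soliton (sol_metric R n) X lam).
Proof.
have lamE := soliton_constants X_soliton.
split=> -[eb1 eb2]; move: X_soliton lamE; rewrite eb1 eb2 => sol lamE;
  by split=> //; lra.
Qed.
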